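(* Let $n$ be a positive integer and let $\ell$ be a nonnegative integer. Then $$\sum_{i=0}^n(-1)^{n-i}\binom{n}{i} i^{\ell}=\begin{cases}0 & \text{if } 0\leq\ell<n,\\[1ex] \displaystyle\sum_{\substack{1\leq i_1\leq i_2\leq\cdots\leq i_n\\ i_1+i_2+\cdots+i_n=\ell}}\frac{\ell!\,N(i_1,i_2,\dots,i_n)}{i_1!\,i_2!\cdots i_n!} & \text{if } \ell\geq n,\end{cases}$$ where the second sum ranges over all nondecreasing $n$-tuples $(i_1,\dots,i_n)$ of positive integers with sum $\ell$.
   Context: For positive integers $i_1,\dots,i_n$, $N(i_1,i_2,\dots,i_n)$ denotes the number of distinct arrangements of the sequence $i_1,i_2,\dots,i_n$, i.e. the number of distinct $n$-tuples obtained by permuting its entries. The convention $0^0=1$ is used (relevant for the term $i=0$ when $\ell=0$). *)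

(* Defs.v *)
From mathcomp Require Import all_boot all_order all_algebra.
Set Implicit Arguments.
Unset Strict Implicit.
Unset Printing Implicit Defensive.

(* [permutations s] is duplicate-free, so this counts distinct arrangements. *)
Definition nb_arrangements (s : seq nat) : nat := size (permutations s).

(* Positive integers with sum l are at most l, so bounding the entries by
   'I_l.+1 only serves to make the index type finite. *)
Definition entries (n l : nat) (t : n.-tuple 'I_l.+1) : seq nat :=
  [seq val i | i <- t].

Definition nondecreasing_composition (n l : nat) (t : n.-tuple 'I_l.+1) : bool :=
  [&& all (fun i => 0 < i) (entries t),
      sorted leq (entries t)
    & \sum_(i <- entries t) i == l].

(* Main.v *)
Require Import Defs.
From mathcomp Require Import all_boot all_order all_algebra.
From mathcomp Require Import ring.
Set Implicit Arguments.
Unset Strict Implicit.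
Unset Printing Implicit Defensive.
Import Order.TTheory GRing.Theory Num.Theory.
Local Open Scope ring_scope.

(** Both sides are [l!] times the coefficient of [x^l] in [(e^x - 1)^n], and
    only the terms of degree at most [l] of the exponential series matter, so
    the series is replaced by the polynomial [truncated_exp l].

    Expanding [(e^x - 1)^n] by the binomial theorem gives the alternating sum,
    because the coefficient of [x^l] in [(e^x)^i = e^(ix)] is [i^l / l!]
    ([coef_truncated_expX]).  Expanding instead the [n]-th power of
    [e^x - 1 = sum_(j >= 1) x^j / j!] by distributivity gives one term
    [1 / (i_1! ... i_n!)] for each ordered composition [(i_1, ..., i_n)] of
    [l] into [n] positive parts ([coef_truncated_exp_sub1X]).  When [l < n]
    there is no such composition.  In general the term depends only on the
    multiset of the parts, and the compositions that sort to a given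
    nondecreasing tuple are exactly its distinct arrangements
    ([sum_composition_sort]). *)

(** Needed to count arrangements of bounded integers, which form a finite
    type, instead of arrangements of the underlying natural numbers. *)
Lemma size_permutations_map (T1 T2 : eqType) (f : T1 -> T2) (s : seq T1) :
  injective f -> size (permutations (map f s)) = size (permutations s).
Proof.
move=> f_inj; rewrite -(size_map (map f)); apply/perm_size/uniq_perm.
- exact: permutations_uniq.
- by rewrite map_inj_uniq ?permutations_uniq //; apply: inj_map.
move=> x; rewrite mem_permutations; apply/idP/mapP => [xs|[t]].
  have /subset_mapP[t _ x_t] : {subset x <= map f s}.
    by move=> y; rewrite (perm_mem xs).
  by exists t; rewrite // mem_permutations (perm_map_inj f_inj) -?x_t.
by rewrite mem_permutations => ts ->; apply: perm_map.
Qed.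

Lemma card_perm_eq_tuple (T : finType) (n : nat) (s : n.-tuple T) :
  #|[pred t : n.-tuple T | perm_eq t s]| = size (permutations s).
Proof.
rewrite cardE -(size_map val); apply/perm_size/uniq_perm.
- by rewrite map_inj_uniq ?enum_uniq //; apply: val_inj.
- exact: permutations_uniq.
move=> x; rewrite mem_permutations; apply/mapP/idP => [[t]|xs].
  by rewrite mem_enum inE => ts ->.
have sz_x : size x == n by rewrite (perm_size xs) size_tuple.
by exists (Tuple sz_x); rewrite // mem_enum inE.
Qed.

Definition truncated_exp (l : nat) : {poly rat} :=
  \poly_(j < l.+1) (j`!%:R)^-1.

Lemma fact_neq0 (j : nat) : j`!%:R != 0 :> rat.
Proof. by rewrite pnatr_eq0 -lt0n fact_gt0. Qed.

(** This is [e^x ^ k = e^(kx)] up to degree [l]; the induction step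
    [e^(kx) e^x = e^((k+1)x)] is the binomial expansion of [(k + 1)^m]. *)
Lemma coef_truncated_expX (l k m : nat) :
  (m <= l)%N -> (truncated_exp l ^+ k)`_m = k%:R ^+ m / m`!%:R.
Proof.
elim: k m => [|k IHk] m le_ml.
  rewrite expr0 coef1 expr0n.
  by case: m le_ml => [|m] _ /=; rewrite ?mul0r ?fact0 ?divr1.
rewrite exprS coefM -natr1 exprDn mulr_suml.
apply: eq_bigr => -[j /= lt_jm] _; have le_jm : (j <= m)%N by [].
rewrite coef_poly ltnS (leq_trans le_jm le_ml).
rewrite IHk ?(leq_trans (leq_subr _ _)) //.
rewrite expr1n mulr1 -mulr_natr -(bin_fact le_jm) !natrM.
have C_neq0 : 'C(m, j)%:R != 0 :> rat by rewrite pnatr_eq0 -lt0n bin_gt0.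
by field; rewrite C_neq0 !fact_neq0.
Qed.

(** Ordered compositions of [l] into [n] positive parts: the condition of
    [nondecreasing_composition] without the sortedness requirement. *)
Definition composition (n l : nat) (t : n.-tuple 'I_l.+1) : bool :=
  all (fun i => (0 < i)%N) (entries t) && (\sum_(i <- entries t) i == l)%N.

Lemma truncated_exp_sub1 (l : nat) :
  truncated_exp l - 1 = \sum_(j < l.+1 | (0 < j)%N) (j`!%:R)^-1 *: 'X^j.
Proof.
rewrite /truncated_exp poly_def (bigD1 ord0) //= fact0 invr1 scale1r expr0.
rewrite addrAC subrr add0r.
by apply: eq_bigl => j; rewrite lt0n.
Qed.

(** Choosing a monomial [x^j / j!] with [1 <= j <= l] in each of the [n] factors
    amounts to choosing an [n]-tuple of positive integers; the choice
    contributes to [x^l] exactly when the entries add up to [l]. *)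
Lemma coef_truncated_exp_sub1X (n l : nat) :
  ((truncated_exp l - 1) ^+ n)`_l =
  \sum_(t : n.-tuple 'I_l.+1 | composition t)
    ((\prod_(i <- entries t) i`!)%:R)^-1.
Proof.
rewrite truncated_exp_sub1 -[in LHS](card_ord n) -prodr_const bigA_distr_big.
rewrite (reindex (fun t : n.-tuple 'I_l.+1 =>
                    [ffun i => tnth t i])) /=; last first.
  exists (fun f : {ffun 'I_n -> 'I_l.+1} => [tuple f i | i < n]) => [t|f] _.
    by apply: eq_from_tnth => i; rewrite tnth_mktuple ffunE.
  by apply/ffunP => i; rewrite ffunE tnth_mktuple.
rewrite coef_sum [RHS]big_mkcondr /=; apply: eq_big => [t|t _].
  apply/ffun_onP/allP => [t_gt0 _ /mapP[_ /tnthP[i ->] ->]|t_gt0 i].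
    by have := t_gt0 i; rewrite ffunE.
  by rewrite ffunE; apply/t_gt0/map_f/mem_tnth.
rewrite !big_map !big_tuple.
under eq_bigr do rewrite ffunE.
rewrite scaler_prod prodrXr coefZ coefXn eq_sym.
case: eqP => _; last by rewrite mulr0.
by rewrite mulr1 natr_prod prodfV.
Qed.

Definition sort_tuple (n l : nat) (t : n.-tuple 'I_l.+1) : n.-tuple 'I_l.+1 :=
  [tuple of sort (relpre val leq) t].

(** Sorting partitions the compositions into fibres; the fibre over a
    nondecreasing [s] is the set of tuples that are permutations of [s], and
    the summand is constant on it. *)
Lemma sum_composition_sort (n l : nat) :
  \sum_(t : n.-tuple 'I_l.+1 | composition t)
    ((\prod_(i <- entries t) i`!)%:R)^-1 =
  \sum_(t : n.-tuple 'I_l.+1 | nondecreasing_composition t)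
    (nb_arrangements (entries t))%:R / (\prod_(i <- entries t) i`!)%:R :> rat.
Proof.
have leq_tot : total (relpre val leq : rel 'I_l.+1).
  by move=> i j; apply: leq_total.
have leq_tr : transitive (relpre val leq : rel 'I_l.+1).
  by move=> i j k; apply: leq_trans.
have leq_anti : antisymmetric (relpre val leq : rel 'I_l.+1).
  by move=> i j /anti_leq/val_inj.
have perm_composition (s t : n.-tuple 'I_l.+1) :
    perm_eq s t -> composition s = composition t.
  move=> /(perm_map val) st.
  by rewrite /composition (perm_all _ st) (perm_big _ st).
have sortK (t : n.-tuple 'I_l.+1) : perm_eq (sort_tuple t) t.
  by rewrite perm_sort.
rewrite (partition_big (@sort_tuple n l) (@nondecreasing_composition n l)) /=.
  apply: eq_bigr => s /and3P[s_gt0 s_sorted s_sum].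
  have fiberE (t : n.-tuple 'I_l.+1) :
      (composition t && (sort_tuple t == s)) = perm_eq t s.
    apply/andP/idP => [[_ /eqP <-]|ts]; first by rewrite perm_sym sortK.
    split; first by rewrite (perm_composition _ _ ts) /composition s_gt0.
    apply/eqP/val_inj/(sorted_eq leq_tr leq_anti).
    - exact: sort_sorted.
    - by rewrite -sorted_map.
    - by rewrite perm_sort.
  rewrite (eq_bigl _ _ fiberE).
  rewrite (eq_bigr (fun=> ((\prod_(i <- entries s) i`!)%:R)^-1)) => [|t ts];
    last first.
    by rewrite (perm_big _ (perm_map val ts)).
  rewrite sumr_const card_perm_eq_tuple -[LHS]mulr_natl.
  by rewrite /nb_arrangements size_permutations_map //; apply: val_inj.
move=> t; rewrite -(perm_composition _ _ (sortK t)) => /andP[t_gt0 t_sum].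
by rewrite /nondecreasing_composition t_gt0 t_sum sorted_map sort_sorted.
Qed.

Lemma composition_leq (n l : nat) (t : n.-tuple 'I_l.+1) :
  composition t -> (n <= l)%N.
Proof.
case/andP=> /allP t_gt0 /eqP <-.
have size_t : size (entries t) = n by rewrite size_map size_tuple.
rewrite -{1}size_t -sum1_size big_seq [leqRHS]big_seq.
exact: leq_sum.
Qed.

Theorem proposition8 (n l : nat) (hn : (0 < n)%N) :
  \sum_(0 <= i < n.+1) (-1) ^+ (n - i) * 'C(n, i)%:R * i%:R ^+ l =
  (if (l < n)%N then 0
   else \sum_(t : n.-tuple 'I_l.+1 | nondecreasing_composition t)
          (l`! * nb_arrangements (entries t))%:R
            / (\prod_(i <- entries t) i`!)%:R) :> rat.
Proof.
(* Writing [e^x - 1] as [-1 + e^x] produces the signs [(-1)^(n - i)] directly. *)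
have -> : \sum_(0 <= i < n.+1) (-1) ^+ (n - i) * 'C(n, i)%:R * i%:R ^+ l =
    l`!%:R * ((truncated_exp l - 1) ^+ n)`_l.
  rewrite addrC exprDn coef_sum mulr_sumr big_mkord; apply: eq_bigr => i _.
  rewrite coefMn -polyCN -polyC_exp coefCM coef_truncated_expX // -mulr_natr.
  by field; rewrite fact_neq0.
rewrite coef_truncated_exp_sub1X; case: ltnP => [lt_ln|_].
  rewrite big_pred0 ?mulr0 // => t; apply/negP => /composition_leq.
  by rewrite leqNgt lt_ln.
rewrite sum_composition_sort mulr_sumr; apply: eq_bigr => t _.
by rewrite natrM mulrA.
Qed.
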